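(* Let $\gamma$ be the restriction to $\mathbb S_+^d$ of a norm on $\mathbb S^d$. Let $0<c_\gamma\le C_\gamma<\infty$ be constants such that $c_\gamma\operatorname{tr}(S)\le\gamma(S)\le C_\gamma\operatorname{tr}(S)$ for every $S\in\mathbb S_+^d$ (such constants always exist). Then, for all $\mu,\nu\in\mathcal P_2(\mathbb R^d)$, $$\sqrt{c_\gamma}\,\mathsf W_2(\mu,\nu)\le \mathsf W_\gamma(\mu,\nu)\le\sqrt{C_\gamma}\,\mathsf W_2(\mu,\nu).$$
   Context: $\mathbb S^d$ is the space of real symmetric $d\times d$ matrices and $\mathbb S_+^d$ the cone of positive semidefinite ones. $\mathcal P_2(\mathbb R^d)$ is the set of Borel probability measures on $\mathbb R^d$ with finite second moment, $\Pi(\mu,\nu)$ is the set of couplings of $\mu$ and $\nu$, and $\mathsf W_2$ is the usual quadratic Wasserstein distance. The static Spectral Wasserstein cost $\mathsf W_\gamma(\mu,\nu)\ge 0$ is defined by $$\mathsf W_\gamma(\mu,\nu)^2=\inf_{\pi\in\Pi(\mu,\nu)}\gamma\left(\int_{\mathbb R^d\times\mathbb R^d}(y-x)(y-x)^\top\,d\pi(x,y)\right).$$ *)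

(* Defs.v *)
From HB Require Import structures.
From mathcomp Require Import all_boot all_order all_algebra.
From mathcomp Require Import all_classical all_reals all_analysis.
Set Implicit Arguments.
Unset Strict Implicit.
Unset Printing Implicit Defensive.
Import Order.TTheory GRing.Theory Num.Theory.
Import numFieldNormedType.Exports.
Local Open Scope classical_set_scope.
Local Open Scope ring_scope.

(* The library norm on matrices is the sup norm; it induces the usual topology
   of R^d, hence the usual Borel sigma-algebra, but it is not the Euclidean
   norm, which is [enorm] below. *)
Definition Rvec (R : realType) (d : nat) :=
  g_sigma_algebraType (@open 'cV[R]_d).

HB.instance Definition _ (R : realType) (d : nat) := Measurable.on (Rvec R d).

Section matrices.
Context {R : realType} {d : nat}.

Definition enorm (x : 'cV[R]_d) : R := Num.sqrt (\sum_(i < d) x i ord0 ^+ 2).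

Definition psdmx (S : 'M[R]_d) : Prop :=
  S \is symmetricmx /\ forall x : 'cV[R]_d, 0 <= (x^T *m S *m x) ord0 ord0.

(* The values of [N] outside the symmetric matrices are irrelevant. *)
Definition norm_on_sym (N : 'M[R]_d -> R) : Prop :=
  [/\ forall A B, A \is symmetricmx -> B \is symmetricmx ->
        N (A + B) <= N A + N B,
      forall (a : R) A, A \is symmetricmx -> N (a *: A) = `|a| * N A &
      forall A, A \is symmetricmx -> N A = 0 -> A = 0].

(* The values of [gamma] outside the PSD cone are irrelevant. *)
Definition restricts_norm (gamma : 'M[R]_d -> R) : Prop :=
  exists2 N, norm_on_sym N & forall S, psdmx S -> gamma S = N S.

Definition trace_bounds (gamma : 'M[R]_d -> R) (c C : R) : Prop :=
  forall S, psdmx S -> c * \tr S <= gamma S /\ gamma S <= C * \tr S.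

End matrices.

Section transport.
Context {R : realType} {d : nat}.
Implicit Types mu nu : probability (Rvec R d) R.

Definition finite_second_moment mu : Prop :=
  (\int[mu]_x (enorm x ^+ 2)%:E < +oo)%E.

Definition couplings mu nu : set (probability (Rvec R d * Rvec R d)%type R) :=
  [set pi : probability (Rvec R d * Rvec R d)%type R |
    forall A, measurable A ->
      pushforward pi fst A = mu A /\ pushforward pi snd A = nu A].

Definition displacement (p : Rvec R d * Rvec R d) : 'cV[R]_d :=
  (p.2 : 'cV[R]_d) - (p.1 : 'cV[R]_d).

Definition displacement_moment
    (pi : probability (Rvec R d * Rvec R d)%type R) : 'M[R]_d :=
  \matrix_(i, j) Rintegral pi setT
    (fun p => (displacement p *m (displacement p)^T) i j).

(* Between measures with finite second moments every coupling has finite cost,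
   so the real-valued integrals and infima below are the genuine ones. *)
Definition W2 mu nu : R :=
  Num.sqrt (inf [set Rintegral pi setT (fun p => enorm (displacement p) ^+ 2)
                | pi in couplings mu nu]).

Definition Wspec (gamma : 'M[R]_d -> R) mu nu : R :=
  Num.sqrt (inf [set gamma (displacement_moment pi) | pi in couplings mu nu]).

End transport.

(* Main.v *)
Require Import Defs.
From mathcomp Require Import all_boot all_order all_algebra.
From mathcomp Require Import all_classical all_reals all_analysis.
From mathcomp Require Import measurable_realfun lra ring.
Import Order.TTheory GRing.Theory Num.Theory.
Import numFieldNormedType.Exports.
Local Open Scope classical_set_scope.
Local Open Scope ring_scope.

(** The trace of the second moment matrix S of the displacement y - x under a
    coupling is the quadratic transport cost of that coupling, because
    tr ((y - x) (y - x)^T) = |y - x|^2 ([tr_displacement_moment]). Moreover S is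
    positive semidefinite, because v^T S v is the integral of (v^T (y - x))^2
    ([displacement_moment_psd]). The assumed comparison of gamma with the trace
    thus reads, coupling by coupling,
      c * cost(pi) <= gamma (S_pi) <= C * cost(pi),
    and passing to infima and square roots gives both inequalities
    ([sqrtr_inf_image_le]). Exchanging trace or quadratic form with the integral
    requires the products of displacement coordinates to be integrable; this is
    where the finite second moments of the two marginals enter
    ([integrable_displacement_mul]).

    The existence of the constants is the equivalence of norms in finite
    dimension: a norm is continuous, hence has a positive minimum on the compact
    unit sphere ([rV_norm_ge]). It compares the given norm with the largest
    absolute value of an entry, and on the positive semidefinite cone that
    value is comparable with the trace: the trace is a sum of d entries, and
    conversely no entry exceeds the trace in absolute value
    ([psdmx_entry_le_tr]). *)

(** * Equivalence of norms in finite dimension *)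

Lemma mx_entry_le_norm {R : realType} {m n} (A : 'M[R]_(m, n)) i j :
  `|A i j| <= `|A|.
Proof.
rewrite [leRHS]/Num.Def.normr /= mx_normrE.
by apply/bigmax_geP; right => /=; exists (i, j).
Qed.

Section norm_equivalence.
Context {R : realType} {n : nat}.
Context (f : 'rV[R]_n -> R).
Context (fD : forall u v, f (u + v) <= f u + f v).
Context (fZ : forall (a : R) u, f (a *: u) = `|a| * f u).
Context (f_eq0 : forall u, f u = 0 -> u = 0).

Lemma rV_norm0 : f 0 = 0.
Proof. by rewrite -(scale0r 0) fZ normr0 mul0r. Qed.

Lemma rV_norm_ge0 u : 0 <= f u.
Proof.
have := fD u ((-1) *: u); rewrite fZ normrN1 mul1r scaleN1r subrr rV_norm0.
by rewrite -mulr2n pmulrn_lge0.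
Qed.

(** Expand u in the standard basis and use subadditivity; the extra 1 in the
    constant keeps it positive in dimension 0. *)
Lemma rV_norm_le : exists2 M, 0 < M & forall u, f u <= M * `|u|.
Proof.
exists (1 + \sum_(j < n) f (delta_mx 0 j)).
  by rewrite ltr_wpDr// sumr_ge0// => j _; exact: rV_norm_ge0.
move=> u; apply: (@le_trans _ _ (\sum_(j < n) `|u 0 j| * f (delta_mx 0 j))).
  rewrite {1}(row_sum_delta u).
  elim/big_ind2 : _ => [|x a y b xa yb|j _]; first by rewrite rV_norm0.
    by rewrite (le_trans (fD _ _))// lerD.
  by rewrite fZ.
rewrite mulrDl mul1r ler_wpDl// mulr_suml; apply: ler_sum => j _.
by rewrite mulrC ler_wpM2l ?rV_norm_ge0// mx_entry_le_norm.
Qed.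

(** The reverse triangle inequality and [rV_norm_le] make f Lipschitz. *)
Lemma rV_norm_continuous : continuous f.
Proof.
have [M M0 fM] := rV_norm_le.
move=> u; apply/(@cvgrPdist_le _ _ _ (nbhs u)) => e e0; near=> v.
suff : `|f u - f v| <= M * `|u - v|.
  move/le_trans; apply; rewrite -ler_pdivlMl// mulrC.
  near: v; apply/(@nbhs_normP _ _ u); exists (e / M); rewrite /= ?divr_gt0//.
  by move=> w; exact: ltW.
rewrite ler_norml; apply/andP; split.
- have := fD u ((-1) *: (u - v)).
  rewrite fZ normrN1 mul1r scaleN1r opprB addrC subrK.
  by have := fM (u - v); lra.
- have := fD (u - v) v; rewrite subrK.
  by have := fM (u - v); lra.
Unshelve. all: by end_near. Qed.

(** f attains a minimum on the compact unit sphere, which is positive by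
    definiteness; homogeneity extends the bound to all vectors. *)
Lemma rV_norm_ge : exists2 m, 0 < m & forall u, m * `|u| <= f u.
Proof.
pose S := [set u : 'rV[R]_n | `|u| = 1].
(* In dimension 0 the sphere is empty and the only vector is 0. *)
have [[v Sv]|S0] := pselect (S !=set0); last first.
  exists 1 => // u; suff -> : u = 0 by rewrite normr0 mulr0 rV_norm0.
  apply/eqP/negPn/negP => u0; apply: S0; exists (`|u|^-1 *: u).
  by rewrite /S/= normrZ normfV normr_id mulVf// normr_eq0.
have cS : compact S.
  apply: bounded_closed_compact.
    by exists 1; split => // x x1 w /= ->; exact: ltW.
  have -> : S = Num.norm @^-1` [set x : R | x = 1] by [].
  apply: closed_comp; last exact: closed_eq.
  by move=> x _; exact: norm_continuous.
have [c /set_mem cS1 cmin] : exists2 c, c \in S & forall t, t \in S -> f c <= f t.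
  apply: EVT_min_rV => //; first by exists v.
  by apply: continuous_subspaceT => x; exact: rV_norm_continuous.
exists (f c).
  rewrite lt_def rV_norm_ge0 andbT; apply/eqP => /f_eq0 c0.
  by move: cS1; rewrite /S/= c0 normr0 => /esym/eqP; rewrite oner_eq0.
move=> u; have [->|u0] := eqVneq u 0; first by rewrite normr0 mulr0 rV_norm0.
have nu0 : 0 < `|u| by rewrite normr_gt0.
have := cmin (`|u|^-1 *: u); rewrite fZ normfV normr_id mulrC.
rewrite ler_pdivlMr//; apply.
by rewrite inE /S/= normrZ normfV normr_id mulVf// gt_eqF.
Qed.
End norm_equivalence.

(** * Norms and traces of symmetric matrices *)

Section symmetric_norms.
Context {R : realType} {d : nat}.

Lemma symmetricmxP (A : 'M[R]_d) : reflect (A^T = A) (A \is symmetricmx).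
Proof.
rewrite is_hermitianmxE expr0 scale1r map_mx_id//.
by rewrite eq_sym; exact: eqP.
Qed.

(** [N] is a norm on a subspace only. It is extended to all matrices by
    A |-> N (A + A^T) + |A - A^T|, which is 2 N on symmetric matrices, and the
    equivalence of norms is applied to this extension, read on row vectors. *)
Lemma norm_on_sym_equiv (N : 'M[R]_d -> R) : norm_on_sym N ->
  exists m M : R, [/\ 0 < m, 0 < M & forall A, A \is symmetricmx ->
    m * `|mxvec A| <= N A /\ N A <= M * `|mxvec A|].
Proof.
move=> [ND NZ N_eq0].
have symD (A : 'M[R]_d) : A + A^T \is symmetricmx.
  by apply/symmetricmxP; rewrite linearD /= trmxK addrC.
have N0 : N 0 = 0.
  by rewrite -(scale0r 0) NZ ?normr0 ?mul0r//; apply/symmetricmxP; rewrite trmx0.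
have N_ge0 (A : 'M[R]_d) : A \is symmetricmx -> 0 <= N A.
  move=> sA; have sNA : (-1) *: A \is symmetricmx.
    by apply/symmetricmxP; rewrite linearZ /= (symmetricmxP _ sA).
  have := ND _ _ sA sNA; rewrite NZ// normrN1 mul1r scaleN1r subrr N0.
  by rewrite -mulr2n pmulrn_lge0.
pose f (u : 'rV[R]_(d * d)) :=
  N (vec_mx u + (vec_mx u)^T) + `|vec_mx u - (vec_mx u)^T|.
have fD u v : f (u + v) <= f u + f v.
  rewrite /f linearD /= linearD /= addrACA opprD.
  rewrite [in X in _ + X](addrACA (vec_mx u)) [leRHS]addrACA.
  by apply: lerD; [exact: ND | exact: ler_normD].
have fZ (a : R) u : f (a *: u) = `|a| * f u.
  by rewrite /f linearZ /= linearZ /= -scalerDr -scalerBr NZ// normrZ mulrDr.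
have f0 u : f u = 0 -> u = 0.
  move=> /eqP; rewrite /f paddr_eq0 ?N_ge0// normr_eq0 subr_eq0.
  move=> /andP[/eqP/(N_eq0 _ (symD _)) h /eqP sym].
  apply: (can_inj vec_mxK); rewrite linear0; move: h; rewrite -sym -mulr2n.
  by rewrite -scaler_nat => /eqP; rewrite scaler_eq0 pnatr_eq0 => /eqP.
have fsym (A : 'M[R]_d) : A \is symmetricmx -> f (mxvec A) = 2 * N A.
  move=> sA; rewrite /f mxvecK (symmetricmxP _ sA) subrr normr0 addr0.
  by rewrite -mulr2n -scaler_nat NZ// normr_nat.
have [M M0 fM] := rV_norm_le _ fD fZ.
have [m m0 fm] := rV_norm_ge _ fD fZ f0.
exists (m / 2), (M / 2); split; [by rewrite divr_gt0 ..|].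
move=> A sA; have := fM (mxvec A); have := fm (mxvec A); rewrite fsym//.
by move=> ? ?; split; lra.
Qed.

Lemma psdmx_diag_ge0 (S : 'M[R]_d) i : psdmx S -> 0 <= S i i.
Proof.
move=> [_ /(_ (delta_mx i 0))]; rewrite trmx_delta -rowE.
by rewrite -colE !mxE.
Qed.

Lemma psdmx_tr_ge0 (S : 'M[R]_d) : psdmx S -> 0 <= \tr S.
Proof. by move=> pS; apply: sumr_ge0 => i _; exact: psdmx_diag_ge0. Qed.

(** The quadratic form at e_i + e_j and at e_i - e_j gives
    2 |S i j| <= S i i + S j j, and each diagonal entry is at most the trace
    because all of them are nonnegative. *)
Lemma psdmx_entry_le_tr (S : 'M[R]_d) i j : psdmx S -> `|S i j| <= \tr S.
Proof.
move=> pS; have [sS hS] := pS.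
have Sji : S j i = S i j by rewrite -[in LHS](symmetricmxP _ sS) mxE.
have quad (e : R) : 0 <= S i i + e ^+ 2 * S j j + 2 * e * S i j.
  have := hS (delta_mx i 0 + e *: delta_mx j 0).
  rewrite [(_ + _)^T]linearD /= [(_ *: _)^T]linearZ /= !trmx_delta.
  rewrite !mulmxDl !mulmxDr -!scalemxAl.
  rewrite -!scalemxAr -!rowE -!colE !mxE Sji.
  by move=> q; lra.
have le_tr k : S k k <= \tr S.
  rewrite /mxtrace (bigD1 k)//= lerDl sumr_ge0// => l _.
  exact: psdmx_diag_ge0.
have := quad 1; have := quad (-1); have := le_tr i; have := le_tr j.
by rewrite ler_norml => ? ? ? ?; apply/andP; split; lra.
Qed.

(** The trace is at most d times the largest entry, and the largest entry is at
    most the trace. The maximum in the upper constant only ensures that it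
    dominates the lower one. *)
Lemma trace_bounds_exist (gamma : 'M[R]_d -> R) : restricts_norm gamma ->
  exists c C : R, [/\ 0 < c, c <= C & trace_bounds gamma c C].
Proof.
move=> [N /norm_on_sym_equiv[m [M [m0 M0 mM]]] gN].
(* d.+1 instead of d, so that the quotient makes sense when d = 0. *)
pose c := m / d.+1%:R.
have c0 : 0 < c by rewrite divr_gt0.
exists c, (Num.max c M); split => //; first by rewrite le_max lexx.
move=> S pS; rewrite gN//; have [sS _] := pS.
have [mS MS] := mM S sS; split.
  apply: le_trans mS; rewrite /c -mulrA ler_wpM2l ?(ltW m0)//.
  rewrite ler_pdivrMl//.
  apply: (@le_trans _ _ (d%:R * `|mxvec S|)); last first.
    by rewrite ler_wpM2r// ler_nat.
  rewrite mulr_natl -[X in _ *+ X]card_ord -sumr_const.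
  apply: ler_sum => i _; rewrite -(mxvecE S i i).
  by rewrite (le_trans (ler_norm _))// mx_entry_le_norm.
apply: (le_trans MS); apply: (@le_trans _ _ (M * \tr S)); last first.
  by rewrite ler_wpM2r ?psdmx_tr_ge0// le_max lexx orbT.
rewrite ler_wpM2l ?(ltW M0)// [leLHS]/Num.Def.normr /= mx_normrE.
apply: bigmax_le => [|[i k] _]; first exact: psdmx_tr_ge0.
rewrite ord1 /=; case/mxvec_indexP: k => a b; rewrite mxvecE.
exact: psdmx_entry_le_tr.
Qed.
End symmetric_norms.

(** * Finite sums of integrals and infima *)

Lemma integrable_sum_EFin {d : measure_display} {T : measurableType d}
    {R : realType} (mu : measure T R) (D : set T) (I : Type) (s : seq I)
    (f : I -> T -> R) : measurable D ->
  (forall i, mu.-integrable D (EFin \o f i)) ->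
  mu.-integrable D (EFin \o (fun x => \sum_(i <- s) f i x)).
Proof.
move=> mD fi; rewrite (_ : _ \o _ = fun x => (\sum_(i <- s) (f i x)%:E)%E).
  by apply: integrable_sum => // i _; exact: fi.
by apply/funext => x /=; rewrite sumEFin.
Qed.

Lemma Rintegral_sum {d : measure_display} {T : measurableType d}
    {R : realType} (mu : measure T R) (D : set T) (I : Type) (s : seq I)
    (f : I -> T -> R) : measurable D ->
  (forall i, mu.-integrable D (EFin \o f i)) ->
  Rintegral mu D (fun x => \sum_(i <- s) f i x) =
  \sum_(i <- s) Rintegral mu D (f i).
Proof.
move=> mD fi; elim: s => [|i s ih].
  rewrite big_nil (_ : (fun _ => _) = cst 0); last first.
    by apply/funext => x; rewrite big_nil.
  by rewrite Rintegral_cst// mul0r.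
rewrite big_cons -ih -RintegralD//; last exact: integrable_sum_EFin.
by apply: eq_Rintegral => x _; rewrite big_cons.
Qed.

(** By convention the infimum of the empty set of reals is 0, so the inequality
    also holds when P is empty: both sides vanish. *)
Lemma sqrtr_inf_image_le {T : Type} {R : realType} (P : set T) (F G : T -> R)
    (a : R) : 0 < a -> (forall t, P t -> 0 <= F t) ->
  (forall t, P t -> F t <= a * G t) ->
  Num.sqrt (inf [set F t | t in P]) <=
  Num.sqrt a * Num.sqrt (inf [set G t | t in P]).
Proof.
move=> a0 F0 FG; rewrite -sqrtrM ?(ltW a0)//; apply: ler_wsqrtr.
have [[t0 Pt0]|P0] := pselect (P !=set0); last first.
  rewrite (_ : P = set0) ?image_set0 ?inf0 ?mulr0//.
  by apply/eqP/negPn/negP => /set0P.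
rewrite -ler_pdivrMl//; apply: lb_le_inf; first by exists (G t0), t0.
move=> _ [t Pt <-]; rewrite ler_pdivrMl//; apply: le_trans (FG _ Pt).
by apply: ge_inf; [exists 0 => _ [u Pu <-]; exact: F0 | exists t].
Qed.

(** * Second moments of the displacement under a coupling *)

Section moments.
Context {R : realType} {d : nat}.

Lemma enorm_sqr (x : 'cV[R]_d) : enorm x ^+ 2 = \sum_(i < d) x i 0 ^+ 2.
Proof. by rewrite sqr_sqrtr// sumr_ge0// => i _; exact: sqr_ge0. Qed.

(** Coordinates are continuous and the sigma-algebra is generated by the open
    sets; open rays generate the Borel sets of the real line. *)
Lemma measurable_coord (i : 'I_d) :
  measurable_fun [set: Rvec R d] (fun x : Rvec R d => (x : 'cV[R]_d) i 0).
Proof.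
apply: (measurability _ (RGenOInfty.measurableE R)) => // _ [_ [x ->] <-].
rewrite setTI; apply: sub_sigma_algebra.
apply: (@open_comp _ _ (fun x : 'cV[R]_d => x i 0)); last exact: interval_open.
by move=> y _; exact: coord_continuous.
Qed.

Lemma integrable_coord_sqr (mu : probability (Rvec R d) R) (i : 'I_d) :
  finite_second_moment mu ->
  mu.-integrable setT (fun x : Rvec R d => ((x : 'cV[R]_d) i 0 ^+ 2)%:E).
Proof.
have mc j : measurable_fun [set: Rvec R d]
    (fun x : Rvec R d => ((x : 'cV[R]_d) j 0 ^+ 2)).
  by apply: measurable_funX; exact: measurable_coord.
move=> mu2; apply/integrableP; split; first exact/measurable_EFinP.
apply: le_lt_trans mu2; apply: ge0_le_integral => //.
- by apply: measurableT_comp => //; exact/measurable_EFinP.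
- apply/measurable_EFinP.
  under eq_fun do rewrite enorm_sqr.
  by apply: measurable_sum => j; exact: mc.
- move=> x _; rewrite abse_EFin lee_fin ger0_norm ?sqr_ge0//.
  rewrite enorm_sqr (bigD1 i)//= lerDl sumr_ge0// => j _.
  exact: sqr_ge0.
Qed.

(** Change of variables; the image measure is only required to agree with mu on
    measurable sets, which is how couplings are specified. *)
Lemma integrable_marginal {d1 d2} {X : measurableType d1} {Y : measurableType d2}
    (pi : probability X R) (mu : probability Y R) (phi : X -> Y) (f : Y -> R) :
  measurable_fun setT phi ->
  (forall A, measurable A -> pushforward pi phi A = mu A) ->
  mu.-integrable setT (EFin \o f) ->
  pi.-integrable setT (EFin \o (f \o phi)).
Proof.
move=> mphi pimu /integrableP[mf foo]; apply/integrableP; split.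
  by have := measurableT_comp mf mphi.
have := @ge0_integral_pushforward _ _ _ _ R _ mphi pi setT
  (fun y => `|(f y)%:E|%E) measurableT.
rewrite preimage_setT => <-//.
- by rewrite (eq_measure_integral mu)// => A mA _; exact: pimu.
- exact: measurableT_comp.
Qed.

Context (mu nu : probability (Rvec R d) R).
Context (mu2 : finite_second_moment mu) (nu2 : finite_second_moment nu).
Context (pi : probability (Rvec R d * Rvec R d)%type R).
Context (pi_coupling : couplings mu nu pi).

Lemma measurable_displacement i : measurable_fun setT
  (fun p : Rvec R d * Rvec R d => displacement p i 0).
Proof.
rewrite (_ : (fun _ => _) = (fun p : Rvec R d * Rvec R d =>
    (p.2 : 'cV[R]_d) i 0 - (p.1 : 'cV[R]_d) i 0)); last first.
  by apply/funext => p; rewrite !mxE.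
apply: measurable_funB.
  exact: measurableT_comp (measurable_coord i) measurable_snd.
exact: measurableT_comp (measurable_coord i) measurable_fst.
Qed.

(** Domination by the marginals: (b - a)^2 <= 2 (a^2 + b^2). *)
Lemma integrable_displacement_sqr i :
  pi.-integrable setT (EFin \o (fun p => displacement p i 0 ^+ 2)).
Proof.
have ix : pi.-integrable setT
    (EFin \o (fun p : Rvec R d * Rvec R d => (p.1 : 'cV[R]_d) i 0 ^+ 2)).
  apply: (integrable_marginal pi mu fst (fun x => (x : 'cV[R]_d) i 0 ^+ 2)).
  - exact: measurable_fst.
  - by move=> A /pi_coupling[].
  - exact: integrable_coord_sqr.
have iy : pi.-integrable setT
    (EFin \o (fun p : Rvec R d * Rvec R d => (p.2 : 'cV[R]_d) i 0 ^+ 2)).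
  apply: (integrable_marginal pi nu snd (fun x => (x : 'cV[R]_d) i 0 ^+ 2)).
  - exact: measurable_snd.
  - by move=> A /pi_coupling[].
  - exact: integrable_coord_sqr.
apply: le_integrable (integrableZl measurableT 2 (integrableD measurableT ix iy)).
- exact: measurableT.
- by apply/measurable_EFinP; apply: measurable_funX; exact: measurable_displacement.
- move=> p _ /=; rewrite lee_fin.
  rewrite !mxE ger0_norm ?sqr_ge0// ger0_norm.
    rewrite -subr_ge0.
    rewrite (_ : _ - _ = ((p.2 : 'cV[R]_d) i 0 + (p.1 : 'cV[R]_d) i 0) ^+ 2).
      exact: sqr_ge0.
    ring.
  by rewrite mulr_ge0// addr_ge0// sqr_ge0.
Qed.

(** Domination by squares: |a b| <= a^2 + b^2. *)
Lemma integrable_displacement_mul i j :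
  pi.-integrable setT
    (EFin \o (fun p => displacement p i 0 * displacement p j 0)).
Proof.
apply: le_integrable (integrableD measurableT
  (integrable_displacement_sqr i) (integrable_displacement_sqr j)).
- exact: measurableT.
- by apply/measurable_EFinP; apply: measurable_funM; exact: measurable_displacement.
- move=> p _ /=; rewrite lee_fin.
  set a := displacement p i 0; set b := displacement p j 0.
  rewrite [leRHS]ger0_norm ?addr_ge0 ?sqr_ge0// ler_norml.
  have := sqr_ge0 (a + b); have := sqr_ge0 (a - b).
  have := sqr_ge0 a; have := sqr_ge0 b.
  by rewrite sqrrB sqrrD => ? ? ? ?; apply/andP; split; lra.
Qed.

Lemma displacement_momentE i j :
  displacement_moment pi i j =
  Rintegral pi setT (fun p => displacement p i 0 * displacement p j 0).
Proof.
by rewrite mxE; apply: eq_Rintegral => p _; rewrite mxE big_ord1 !mxE.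
Qed.

(** The quadratic form of the moment matrix at x is the integral of the square
    of the scalar product of x with the displacement. *)
Lemma displacement_moment_psd : psdmx (displacement_moment pi).
Proof.
split.
  apply/symmetricmxP/matrixP => i j; rewrite mxE !displacement_momentE.
  by apply: eq_Rintegral => p _; rewrite mulrC.
move=> x.
have int1 i j : pi.-integrable setT (EFin \o
    (fun p => x i 0 * (displacement p i 0 * displacement p j 0) * x j 0)).
  rewrite (_ : _ \o _ = (fun p => ((x i 0 * x j 0)%:E *
      (displacement p i 0 * displacement p j 0)%:E)%E)); last first.
    by apply/funext => p /=; rewrite -EFinM; congr (_%:E); ring.
  by apply: integrableZl => //; exact: integrable_displacement_mul.
have -> : (x^T *m displacement_moment pi *m x) 0 0 =
    Rintegral pi setT (fun p => (\sum_i x i 0 * displacement p i 0) ^+ 2).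
  transitivity (\sum_j \sum_i Rintegral pi setT
      (fun p => x i 0 * (displacement p i 0 * displacement p j 0) * x j 0)).
    rewrite mxE; apply: eq_bigr => j _; rewrite mxE mulr_suml.
    apply: eq_bigr => i _; rewrite displacement_momentE mxE.
    rewrite [LHS](_ : _ = (x i 0 * x j 0) * Rintegral pi setT
      (fun p => displacement p i 0 * displacement p j 0)); last ring.
    rewrite -RintegralZl//; last exact: integrable_displacement_mul.
    by apply: eq_Rintegral => p _; ring.
  under eq_bigr => j _ do rewrite -Rintegral_sum//.
  rewrite -Rintegral_sum//; last by move=> j; exact: integrable_sum_EFin.
  apply: eq_Rintegral => p _; rewrite expr2 mulr_sumr; apply: eq_bigr => j _.
  by rewrite mulr_suml; apply: eq_bigr => i _; ring.
by apply: Rintegral_ge0 => p _; exact: sqr_ge0.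
Qed.

Lemma tr_displacement_moment :
  \tr (displacement_moment pi) =
  Rintegral pi setT (fun p => enorm (displacement p) ^+ 2).
Proof.
rewrite /mxtrace; under eq_bigr => i _ do rewrite displacement_momentE.
rewrite -Rintegral_sum//; last by move=> i; exact: integrable_displacement_mul.
apply: eq_Rintegral => p _; rewrite enorm_sqr.
by apply: eq_bigr => i _; rewrite expr2.
Qed.

End moments.

Theorem proposition3p2 (R : realType) (d : nat) (gamma : 'M[R]_d -> R)
    (hgamma : restricts_norm gamma) :
  (exists c C : R, [/\ 0 < c, c <= C & trace_bounds gamma c C]) /\
  (forall c C : R, 0 < c -> c <= C -> trace_bounds gamma c C ->
   forall mu nu : probability (Rvec R d) R,
     finite_second_moment mu -> finite_second_moment nu ->
     Num.sqrt c * W2 mu nu <= Wspec gamma mu nu /\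
     Wspec gamma mu nu <= Num.sqrt C * W2 mu nu).
Proof.
split; first exact: trace_bounds_exist.
move=> c C c0 cC gcC mu nu mu2 nu2.
have bounds pi : couplings mu nu pi ->
    c * Rintegral pi setT (fun p => enorm (displacement p) ^+ 2)
      <= gamma (displacement_moment pi) /\
    gamma (displacement_moment pi) <=
      C * Rintegral pi setT (fun p => enorm (displacement p) ^+ 2).
  move=> pi_c; rewrite -(tr_displacement_moment _ _ mu2 nu2 _ pi_c).
  by apply: gcC; exact: (displacement_moment_psd _ _ mu2 nu2 _ pi_c).
have cost_ge0 pi :
    0 <= Rintegral pi setT (fun p => enorm (@displacement R d p) ^+ 2).
  by apply: Rintegral_ge0 => p _; exact: sqr_ge0.
split.
  (* The lower bound is an upper bound of the cost by c^-1 times gamma. *)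
  rewrite -ler_pdivlMl ?sqrtr_gt0// -sqrtrV ?(ltW c0)//.
  apply: sqrtr_inf_image_le => [|//|pi /bounds[? _]].
    by rewrite invr_gt0.
  by rewrite ler_pdivlMl.
apply: sqrtr_inf_image_le => [|pi /bounds[h _]|pi /bounds[]//].
  exact: lt_le_trans c0 cC.
by apply: le_trans h; rewrite mulr_ge0// ltW.
Qed.
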